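(* Let $A$ be the adjacency matrix of the path graph $P_{11}$ on $11$ vertices, and for $t\in\mathbb{R}$ let $U(t)=\exp(itA)$ and $M(t)=U(t)\circ\overline{U(t)}$, so that $M_{pq}(t)=|U_{pq}(t)|^2$. Then for every probability measure $\mu$ on $\mathbb{R}$, $$\int_{\mathbb{R}} M(t)\,d\mu(t)\neq \frac{1}{11}J,$$ where $J$ is the $11\times 11$ all-ones matrix. That is, no probability measure on $\mathbb{R}$ achieves uniform average mixing on $P_{11}$.
   Context: The path $P_{11}$ has vertices $1,\dots,11$ with $p$ and $q$ adjacent if and only if $|p-q|=1$. The symbol $\circ$ denotes the entrywise (Hadamard/Schur) product of matrices, and the bar denotes entrywise complex conjugation. Probability measures on $\mathbb{R}$ are Borel probability measures, and the integral of a matrix-valued function is taken entrywise. For a graph on $n$ vertices, with $U(t)$ and $M(t)$ defined in the same way from its adjacency matrix, uniform average mixing under a probability measure $\mu$ means $\int_{\mathbb{R}}M(t)\,d\mu(t)=\frac{1}{n}J$, where $J$ is the $n\times n$ all-ones matrix. *)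

(* Defs.v *)
From HB Require Import structures.
From mathcomp Require Import all_boot all_order all_algebra.
From mathcomp Require Import all_classical all_reals all_analysis.
From mathcomp Require Import complex.

Set Implicit Arguments.
Unset Strict Implicit.
Unset Printing Implicit Defensive.

Import Order.TTheory GRing.Theory Num.Theory.
Import numFieldNormedType.Exports.

Local Open Scope classical_set_scope.
Local Open Scope ring_scope.
Local Open Scope complex_scope.

(* [R[i]] carries no topology of its own: equip it with the one induced by its
   modulus, so that limits can be taken in ['M[R[i]]_n]. *)
HB.instance Definition _ (R : realType) := NormedModule.copy R[i] R[i]^o.

Section Definitions.
Context {R : realType}.
Implicit Types n : nat.

Definition expmx n (X : 'M[R[i]]_n) : 'M[R[i]]_n :=
  limn (series (fun k => (k`!%:R : R[i])^-1 *: X ^+ k)).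

Definition hadamard n (X Y : 'M[R[i]]_n) : 'M[R[i]]_n := map2_mx *%R X Y.

Definition adjacency_mx n (e : rel 'I_n) : 'M[R[i]]_n :=
  \matrix_(p, q) (e p q)%:R.

(* Vertices are numbered from 0, which leaves [p - q] unchanged; the
   difference is taken in [int]. *)
Definition path_graph n : rel 'I_n :=
  fun p q => `|(p : int) - (q : int)| == 1.

Definition transition_mx n (A : 'M[R[i]]_n) (t : R) : 'M[R[i]]_n :=
  expmx (('i%C * t%:C) *: A).

Definition mixing_mx n (A : 'M[R[i]]_n) (t : R) : 'M[R[i]]_n :=
  hadamard (transition_mx A t) (map_mx Num.conj (transition_mx A t)).

Definition Cintegral (mu : probability (measurableTypeR R) R) (f : R -> R[i]) :
    R[i] :=
  (\int[mu]_t complex.Re (f t)) +i* (\int[mu]_t complex.Im (f t)).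

Definition mxintegral n (mu : probability (measurableTypeR R) R)
    (F : R -> 'M[R[i]]_n) : 'M[R[i]]_n :=
  \matrix_(p, q) Cintegral mu (fun t => F t p q).

End Definitions.

(* Main.v *)
Require Import Defs.
From mathcomp Require Import all_boot all_order all_algebra.
From mathcomp Require Import all_classical all_reals all_analysis.
From mathcomp Require Import complex.
From mathcomp Require Import ring lra zify.

(* Write l_r = 2 cos (r pi / 12) for the eigenvalues of the path, and number its
   vertices from 1. As sin (r pi (12 - p) / 12) = -(-1)^r sin (r pi p / 12), the sums
   U_{p,p} + U_{p,12-p} and U_{p,p} - U_{p,12-p} only involve odd, respectively
   even, r, and with C = cos (l_1 t) + cos (l_3 t) + cos (l_5 t) one finds
     sum_{p <= 5} (-1)^p (|U_{p,p}|^2 - |U_{p,12-p}|^2) = - C / 3,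
     U_{6,6} = C / 3.
   Since l_1 = l_3 + l_5, adding 3/2 |U_{6,6}|^2 + 2 |U_{1,6}|^2 - |U_{3,6}|^2
   + 2 |U_{5,6}|^2 cancels everything that depends on t and leaves 1/2. The weights
   of this combination add up to 9/2, so under uniform average mixing its
   integral would be 9/22. *)

Import Order.TTheory GRing.Theory Num.Theory.
Import numFieldNormedType.Exports.
Local Open Scope ring_scope.

Section AverageMixing.
Context {R : realType}.

(** * Exponential series of a spectrally decomposed matrix *)

Lemma cvg_real_complex (u : R^nat) (l : R) :
  (u @ \oo --> l)%classic ->
  ((fun k => (u k)%:C%C : R[i]) @ \oo --> (l%:C%C : R[i]))%classic.
Proof.
move=> /cvgrPdist_lt ul; apply/cvgrPdist_lt => e e0.
(* In the order of [R[i]] a positive element has imaginary part 0. *)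
have [e' e'E e'0] : exists2 e' : R, e = e'%:C%C & 0 < e'.
  case: e e0 => a b; rewrite ltcE /= => /andP[/eqP -> a0]; by exists a.
near=> k; rewrite -rmorphB normc_def /= expr0n addr0 sqrtr_sqr e'E ltcR.
by near: k; exact: ul.
Unshelve. all: by end_near. Qed.

Definition expi (x : R) : R[i] := (cos x +i* sin x)%C.

(** Powers of ['i] split by parity: even [k] feed only the cosine series, odd [k] only the sine
    series. *)
Lemma expi_coeff (x : R) k :
  (k`!%:R : R[i])^-1 * ('i%C * x%:C%C) ^+ k =
  (cos_coeff x k)%:C%C + 'i%C * (sin_coeff x k)%:C%C.
Proof.
have i2 j : ('i%C : R[i]) ^+ j.*2 = ((-1) ^+ j)%:C%C.
  by rewrite -muln2 mulnC exprM sqr_i rmorphXn rmorphN1.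
have ik : ('i%C : R[i]) ^+ k =
    ((~~ odd k)%:R * (-1) ^+ k./2)%:C%C + 'i%C * ((odd k)%:R * (-1) ^+ k.-1./2)%:C%C.
  rewrite -[in LHS](odd_double_half k) exprD i2.
  case: (boolP (odd k)) => ok /=.
    have -> : k.-1./2 = k./2 by rewrite -{1}(odd_double_half k) ok add1n /= doubleK.
    by rewrite mul0r rmorph0 add0r mul1r expr1.
  by rewrite mul0r rmorph0 mulr0 addr0 !mul1r.
rewrite exprMn ik /cos_coeff /sin_coeff /= !rmorphM /= !fmorphV !rmorph_nat.
by rewrite !rmorphXn /=; ring.
Qed.

Lemma cvg_expi (x : R) :
  (series (fun k => (k`!%:R : R[i])^-1 * ('i%C * x%:C%C) ^+ k) @ \oo -->
   expi x)%classic.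
Proof.
have -> : expi x = (cos x)%:C%C + 'i%C * (sin x)%:C%C.
  by rewrite /expi; simpc.
rewrite [X in (X @ _ --> _)%classic](_ : _ = (fun n =>
   (series (cos_coeff x) n)%:C%C + 'i%C * (series (sin_coeff x) n)%:C%C)); last first.
  apply/funext => n; rewrite /series /= !rmorph_sum mulr_sumr -big_split /=.
  by apply: eq_bigr => k _; exact: expi_coeff.
apply: cvgD; last apply: cvgMl_tmp; apply: cvg_real_complex.
  have := @is_cvg_series_cos_coeff R x; rewrite unlock; exact.
have := @is_cvg_series_sin_coeff R x; rewrite unlock; exact.
Qed.

Lemma exprZmx n (c : R[i]) (A : 'M[R[i]]_n) k : (c *: A) ^+ k = c ^+ k *: A ^+ k.
Proof.
elim: k => [|k IH]; first by rewrite !expr0 scale1r.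
by rewrite !exprS IH -!mulmxE -scalemxAl -scalemxAr scalerA.
Qed.

(** Inserting the formula for [A ^+ k], with [k = 0] included, splits the exponential series into
    one scalar series per [r]. *)
Lemma transition_mxE n (I : finType) (A : 'M[R[i]]_n) (l : I -> R)
    (E : I -> 'M[R[i]]_n) (t : R) :
  (forall k, A ^+ k = \sum_r (l r ^+ k)%:C%C *: E r) ->
  transition_mx A t = \sum_r expi (l r * t) *: E r.
Proof.
move=> AE; apply: cvg_lim; first exact: norm_hausdorff.
rewrite [X in (X @ _ --> _)%classic](_ : _ = (fun n => \sum_r
   series (fun k => (k`!%:R : R[i])^-1 * ('i%C * (l r * t)%:C%C) ^+ k) n *:
     E r)); last first.
  apply/funext => m; rewrite /series /=.
  under [RHS]eq_bigr do rewrite scaler_suml.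
  rewrite exchange_big /=; apply: eq_bigr => k _.
  rewrite exprZmx AE !scaler_sumr; apply: eq_bigr => r _.
  rewrite !scalerA; congr (_ *: _).
  by rewrite !exprMn !rmorphM /= exprMn !rmorphXn /=; ring.
apply: cvg_big => [|r _]; first exact: add_continuous.
apply: cvgZr_tmp; exact: cvg_expi.
Qed.

(** * Spectral decomposition of the path *)

Lemma sinBnatpi k (x : R) : sin (k%:R * pi - x) = - (-1) ^+ k * sin x.
Proof.
elim: k => [|k IH]; first by rewrite mul0r sub0r sinN expr0 mulN1r.
by rewrite mulrSr mulrDl mul1r addrAC sinDpi IH exprS; ring.
Qed.

(** The bounds on [k] put [x / 2] strictly between 0 and pi, so the telescoping factor
    [2 * sin (x / 2)] can be cancelled. *)
Lemma sum_cos (N k : nat) : (0 < k < 2 * N)%N ->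
  \sum_(r < N) cos (r%:R * (k%:R * (pi / N%:R))) = (odd k)%:R :> R.
Proof.
case/andP=> k0 kN; set x := k%:R * _.
have N0 : 0 < N%:R :> R by rewrite ltr0n; case: N kN {x} => //; rewrite muln0.
have Nx : N%:R * x = k%:R * pi by rewrite /x; field; rewrite gt_eqF.
have s0 : sin (x / 2) != 0.
  have x0 : 0 < x by rewrite /x mulr_gt0 ?ltr0n // divr_gt0 ?pi_gt0.
  rewrite gt_eqF// sin_gt0_pi// divr_gt0//= ltr_pdivrMr// -(ltr_pM2l N0) Nx.
  by rewrite mulrA mulrAC ltr_pM2r ?pi_gt0// -natrM ltr_nat mulnC.
(* 2 sin (x / 2) cos (r x) = sin ((r + 1/2) x) - sin ((r - 1/2) x) telescopes. *)
have tele m : 2 * sin (x / 2) * \sum_(r < m) cos (r%:R * x) =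
    sin (m%:R * x - x / 2) + sin (x / 2).
  elim: m => [|m IH]; first by rewrite big_ord0 mul0r sub0r sinN; ring.
  rewrite big_ord_recr /= mulrDr IH.
  have -> : m.+1%:R * x - x / 2 = m%:R * x + x / 2 by rewrite -natr1; field.
  by rewrite sinB sinD; ring.
apply: (mulfI (mulf_neq0 (_ : 2 != 0) s0)) => //.
rewrite tele Nx sinBnatpi -signr_odd.
by case: (odd k) => /=; rewrite ?expr0 ?expr1; ring.
Qed.

(** By product-to-sum this is half the difference of two cosine sums, at [p - q] and [p + q + 2].
    These have equal parity, so the sums cancel by [sum_cos] unless [p = q], when the first consists
    of ones. *)
Lemma sum_sin_sin (n : nat) (p q : 'I_n) :
  \sum_(r < n) sin (r.+1%:R * (p.+1%:R * (pi / n.+1%:R))) *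
               sin (r.+1%:R * (q.+1%:R * (pi / n.+1%:R))) =
  (p == q)%:R * (n.+1%:R / 2) :> R.
Proof.
wlog qp : p q / (q <= p)%N.
  move=> H; case: (leqP q p) => [/H//|/ltnW /H]; rewrite eq_sym => <-.
  by apply: eq_bigr => r _; rewrite mulrC.
set t := pi / _.
(* The extra term [r = 0] is [cos 0 - cos 0]. *)
transitivity (\sum_(r < n.+1) (cos (r%:R * ((p - q)%:R * t)) -
                               cos (r%:R * ((p + q).+2%:R * t))) / 2).
  rewrite big_ord_recl /= !mul0r subrr mul0r add0r; apply: eq_bigr => r _.
  rewrite natrB// -[(p + q).+2]addn2 /bump add1n (natrD _ (p + q)).
  rewrite (natrD _ p) -(natr1 r) -(natr1 p) -(natr1 q).
  set u := (r%:R + 1) * ((p%:R + 1) * t); set v := (r%:R + 1) * ((q%:R + 1) * t).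
  have -> : (r%:R + 1) * ((p%:R - q%:R) * t) = u - v by rewrite /u /v; ring.
  have -> : (r%:R + 1) * ((p%:R + q%:R + 2) * t) = u + v by rewrite /u /v; ring.
  by rewrite cosB cosD; field.
rewrite -mulr_suml sumrB [X in _ - X]sum_cos; last by have := ltn_ord p; lia.
case: eqVneq => [->|pq].
  rewrite subnn; under eq_bigr do rewrite mul0r mulr0 cos0.
  by rewrite sumr_const card_ord -addn2 oddD addnn odd_double mul1r subr0.
have {}qp : (q < p)%N by rewrite ltn_neqAle qp andbT eq_sym.
rewrite sum_cos; last by have := ltn_ord p; lia.
by rewrite /= negbK oddD oddB ?(ltnW qp)// subrr !mul0r.
Qed.

Definition path_eigval {n} (r : 'I_n) : R := 2 * cos (r.+1%:R * (pi / n.+1%:R)).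

(** Entry of the orthogonal projector onto the eigenvector with coordinates sin ((r+1)(p+1) pi /
    (n+1)), whose squared norm is (n+1)/2. *)
Definition path_proj {n} (r p q : 'I_n) : R :=
  2 / n.+1%:R * (sin (r.+1%:R * (p.+1%:R * (pi / n.+1%:R))) *
                 sin (r.+1%:R * (q.+1%:R * (pi / n.+1%:R)))).

(** [F] is indexed by vertices numbered from 1; its zeros at 0 and [n.+1] stand in for the missing
    neighbours of the two ends. *)
Lemma sum_path_graph n (p : 'I_n) (F : nat -> R) : F 0 = 0 -> F n.+1 = 0 ->
  \sum_(j < n) (@path_graph n p j)%:R * F j.+1 = F p + F p.+2.
Proof.
move=> F0 Fn.
have pgE (j : 'I_n) : (@path_graph n p j)%:R =
    (j.+1 == p :> nat)%:R + (j == p.+1 :> nat)%:R :> R.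
  rewrite -natrD /path_graph; congr (_%:R); lia.
under eq_bigr do rewrite pgE mulrDl.
rewrite big_split /=; congr (_ + _).
  rewrite -[F p]mul1r; have [p0|p0] := posnP p.
    by rewrite big1 => [|j _]; rewrite p0 ?F0 ?mulr0 // mul0r.
  have pn : (p.-1 < n)%N by have := ltn_ord p; lia.
  rewrite (bigD1 (Ordinal pn)) //= prednK // eqxx big1 ?addr0 // => j.
  by rewrite -val_eqE /= => jp; case: eqP => [e|_]; rewrite ?mul0r//; lia.
rewrite -[F p.+2]mul1r; have [pn|pn] := ltnP p.+1 n.
  rewrite (bigD1 (Ordinal pn)) //= eqxx big1 ?addr0 // => j.
  by rewrite -val_eqE /= => jp; case: eqP => [e|_]; rewrite ?mul0r//; lia.
have -> : p.+2 = n.+1 by have := ltn_ord p; lia.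
rewrite Fn mulr0 big1// => j _.
by case: eqP => [e|_]; rewrite ?mul0r//; have := ltn_ord j; lia.
Qed.

(** The case [k = 0] is the orthogonality relation [sum_sin_sin]; the step is the eigenvector
    equation sin (x - s) + sin (x + s) = 2 cos s sin x. *)
Lemma path_adjacency_exp n k :
  adjacency_mx (@path_graph n) ^+ k =
  \sum_(r < n) (path_eigval r ^+ k)%:C%C *:
    (\matrix_(p, q) (path_proj r p q)%:C%C) :> 'M[R[i]]_n.
Proof.
elim: k => [|k IH].
  apply/matrixP => p q; rewrite !mxE summxE.
  under eq_bigr do rewrite !mxE -rmorphM /= mul1r.
  rewrite -rmorph_sum /= -mulr_sumr sum_sin_sin mulrCA.
  have -> : 2 / n.+1%:R * (n.+1%:R / 2) = 1 :> R.
    by field; rewrite addrC natr1 pnatr_eq0.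
  by rewrite mulr1 rmorph_nat.
rewrite exprS IH -mulmxE mulmx_sumr; apply: eq_bigr => r _.
rewrite -scalemxAr exprSr rmorphM -scalerA; congr (_ *: _).
apply/matrixP => p q; rewrite !mxE.
under eq_bigr do rewrite !mxE -(rmorph_nat (real_complex R)) -rmorphM /=.
rewrite -rmorph_sum -rmorphM /=; congr (_%:C%C).
pose F j : R := 2 / n.+1%:R * (sin (r.+1%:R * (j%:R * (pi / n.+1%:R))) *
                 sin (r.+1%:R * (q.+1%:R * (pi / n.+1%:R)))).
rewrite (@sum_path_graph n p F); last 2 first.
- by rewrite /F mul0r mulr0 sin0 mul0r mulr0.
- rewrite /F [n.+1%:R * _]mulrC divfK ?pnatr_eq0//.
  by rewrite -[X in sin X]subr0 sinBnatpi sin0 !(mulr0, mul0r).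
rewrite /F /path_proj /path_eigval -[p.+2]addn2 natrD -(natr1 p) -(natr1 r).
set t := pi / _; set a := r%:R + 1; set y := sin (a * (q.+1%:R * t)).
set x := a * ((p%:R + 1) * t).
have -> : a * (p%:R * t) = x - a * t by rewrite /x; ring.
have -> : a * ((p%:R + 2) * t) = x + a * t by rewrite /x; ring.
by rewrite sinB sinD; ring.
Qed.

(** * Sines of multiples of [pi / 12] in radicals *)

Lemma sin_pi6 : sin (pi / 6) = 1 / 2 :> R.
Proof.
set u := pi / 6; have s0 : 0 < sin u.
  rewrite sin_gt0_pi// /u divr_gt0 ?pi_gt0//=.
  by rewrite ltr_pdivrMr// ltr_pMr ?pi_gt0// ltr1n.
have s3 : sin (u + u + u) = 1.
  by rewrite -[RHS]sin_pihalf; congr sin; rewrite /u; field.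
(* 1 - sin (3 u) = 1 - 3 sin u + 4 sin^3 u = (sin u + 1) (2 sin u - 1)^2 *)
have /eqP : (sin u + 1) * (2 * sin u - 1) ^+ 2 = 0.
  transitivity (1 - (3 * cos u ^+ 2 * sin u - sin u ^+ 3)).
    by rewrite cos2sin2; ring.
  by apply/eqP; rewrite subr_eq0 -[X in X == _]s3 !(sinD, cosD); apply/eqP; ring.
by rewrite mulf_eq0 sqrf_eq0 => /orP[] /eqP ?; lra.
Qed.

Lemma sin_pi4 : sin (pi / 4) = Num.sqrt 2 / 2 :> R.
Proof.
have cs : cos (pi / 4) = sin (pi / 4) :> R.
  by rewrite -[RHS]cosBpihalf -cosN; congr cos; field.
have : sin (pi / 4) ^+ 2 = (Num.sqrt 2 / 2) ^+ 2 :> R.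
  have := cos2Dsin2 (pi / 4 : R); rewrite cs exprMn sqr_sqrtr // => ?; lra.
have s0 : 0 < sin (pi / 4) :> R.
  by rewrite sin_gt0_pi// divr_gt0 ?pi_gt0//= ltr_pdivrMr// ltr_pMr ?pi_gt0// ltr1n.
by move/eqP; rewrite eqrXn2 ?divr_ge0 ?ltW// => /eqP.
Qed.

Lemma cos_pi4 : cos (pi / 4) = Num.sqrt 2 / 2 :> R.
Proof.
by rewrite -sin_pi4 -[RHS]cosBpihalf -cosN; congr cos; field.
Qed.

Lemma cos_pi6 : cos (pi / 6) = Num.sqrt 3 / 2 :> R.
Proof.
have c0 : 0 < cos (pi / 6) :> R.
  by apply: cos_gt0_pihalf; have := pi_gt0 R; lra.
have : cos (pi / 6) ^+ 2 = (Num.sqrt 3 / 2) ^+ 2 :> R.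
  by rewrite cos2sin2 sin_pi6 !exprMn sqr_sqrtr//; field.
by move/eqP; rewrite eqrXn2 ?divr_ge0 ?ltW// => /eqP.
Qed.

Lemma cos_pi3 : cos (pi / 3) = 1 / 2 :> R.
Proof. by rewrite -sin_pi6 -[RHS]cosBpihalf -cosN; congr cos; field. Qed.

Lemma sin_pi3 : sin (pi / 3) = Num.sqrt 3 / 2 :> R.
Proof. by rewrite -cos_pi6 -cosBpihalf -cosN; congr cos; field. Qed.

(** Values of sin (k pi / 12), in a form that reduces by computation; the last case is the sign
    change under a half turn. *)
Fixpoint sintab (k : nat) : R :=
  match k with
  | 0 => 0
  | 1 => Num.sqrt 2 * (Num.sqrt 3 - 1) / 4
  | 2 => 1 / 2
  | 3 => Num.sqrt 2 / 2
  | 4 => Num.sqrt 3 / 2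
  | 5 => Num.sqrt 2 * (Num.sqrt 3 + 1) / 4
  | 6 => 1
  | 7 => Num.sqrt 2 * (Num.sqrt 3 + 1) / 4
  | 8 => Num.sqrt 3 / 2
  | 9 => Num.sqrt 2 / 2
  | 10 => 1 / 2
  | 11 => Num.sqrt 2 * (Num.sqrt 3 - 1) / 4
  | k'.+4.+4.+4 => - sintab k'
  end.

Lemma sin_pi12 k : sin (k%:R * (pi / 12)) = sintab k :> R.
Proof.
have s1 : sin (pi / 12) = Num.sqrt 2 * (Num.sqrt 3 - 1) / 4 :> R.
  have -> : pi / 12 = pi / 3 - pi / 4 :> R by field.
  by rewrite sinB sin_pi3 cos_pi3 sin_pi4 cos_pi4; field.
have s5 : sin (pi / 6 + pi / 4) = Num.sqrt 2 * (Num.sqrt 3 + 1) / 4 :> R.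
  by rewrite sinD sin_pi6 cos_pi6 sin_pi4 cos_pi4; field.
have refl (u v : R) : u + v = pi -> sin u = sin v.
  by move=> uv; rewrite -[RHS]opprK -sinN -sinDpi -uv; congr sin; ring.
elim/ltn_ind: k => -[|[|[|[|[|[|[|[|[|[|[|[|k]]]]]]]]]]]] IH; rewrite [RHS]/=.
- by rewrite mul0r sin0.
- by rewrite mul1r.
- by rewrite -sin_pi6; congr sin; field.
- by rewrite -sin_pi4; congr sin; field.
- by rewrite -sin_pi3; congr sin; field.
- by rewrite -s5; congr sin; field.
- by rewrite -[RHS]sin_pihalf; congr sin; field.
- by rewrite -s5; apply: refl; field.
- by rewrite -sin_pi3; apply: refl; field.
- by rewrite -sin_pi4; apply: refl; field.
- by rewrite -sin_pi6; apply: refl; field.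
- by rewrite -s1; apply: refl; field.
rewrite -(IH k); last by lia.
rewrite -sinDpi.
by congr sin; rewrite (_ : k.+4.+4.+4 = k + 12)%N ?natrD; [field | lia].
Qed.

(** * Mixing probabilities and the time-independent combination *)

Definition path_prob {n} (p q : 'I_n) (t : R) : R :=
  (\sum_(r < n) path_proj r p q * cos (path_eigval r * t)) ^+ 2 +
  (\sum_(r < n) path_proj r p q * sin (path_eigval r * t)) ^+ 2.

Lemma path_mixing n (p q : 'I_n) (t : R) :
  mixing_mx (adjacency_mx (@path_graph n)) t p q = (path_prob p q t)%:C%C.
Proof.
rewrite !mxE (transition_mxE _ _ _ _ _ _ (path_adjacency_exp n)) summxE.
set c := \sum_(r < n) path_proj r p q * cos (path_eigval r * t).
set s := \sum_(r < n) path_proj r p q * sin (path_eigval r * t).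
rewrite (_ : \sum_r _ = (c +i* s)%C).
  by rewrite /path_prob -/c -/s; simpc; rewrite -!expr2 [s * c]mulrC addNr.
transitivity (c%:C%C + 'i%C * s%:C%C); last by simpc.
rewrite /c /s !rmorph_sum mulr_sumr -big_split /=; apply: eq_bigr => r _.
rewrite !mxE /expi !rmorphM /=; simpc.
by rewrite ![_ * path_proj _ _ _]mulrC.
Qed.

(* [P k] is a product of two sines expanded into a difference of cosines, so that
   [Num.sqrt 2] and [Num.sqrt 3] occur with degree at most one in it. *)
Lemma path11_sum (f : R -> R) (p q : 'I_11) (t : R) : (p <= q)%N ->
  let P k := (sintab (k * (q - p) + 6) - sintab (k * (p + q).+2 + 6)) / 2 : R in
  let L1 := Num.sqrt 2 * (Num.sqrt 3 + 1) / 2 * t in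
  let L2 := Num.sqrt 3 * t in
  let L3 := Num.sqrt 2 * t in
  let L5 := Num.sqrt 2 * (Num.sqrt 3 - 1) / 2 * t in
  \sum_(r < 11) path_proj r p q * f (path_eigval r * t) =
  (P 1 * f L1 + P 2 * f L2 + P 3 * f L3 + P 4 * f t + P 5 * f L5 + P 6 * f 0 +
   P 7 * f (- L5) + P 8 * f (- t) + P 9 * f (- L3) + P 10 * f (- L2) +
   P 11 * f (- L1)) / 6.
Proof.
move=> pq P L1 L2 L3 L5.
(* A quarter turn is six steps of [pi / 12], hence the shifts by 6 in [P]. *)
have cos_pi12 k : cos (k%:R * (pi / 12)) = sintab (k + 6) :> R.
  by rewrite -sin_pi12 -sinDpihalf natrD; congr sin; field.
transitivity (\sum_(r < 11) P r.+1 * f (2 * sintab (r.+1 + 6) * t) / 6).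
  apply: eq_bigr => r _; rewrite /path_eigval /path_proj /P -!cos_pi12.
  set u := r.+1%:R * (p.+1%:R * _); set v := r.+1%:R * (q.+1%:R * _).
  have -> : (r.+1 * (q - p))%:R * (pi / 12) = v - u :> R.
    by rewrite natrM natrB // /u /v -(natr1 p) -(natr1 q); ring.
  have -> : (r.+1 * (p + q).+2)%:R * (pi / 12) = v + u :> R.
    by rewrite natrM -addSn -addnS natrD /u /v; ring.
  by rewrite cosB cosD; field.
rewrite -(big_mkord xpredT (fun r => P r.+1 * f (2 * sintab (r.+1 + 6) * t) / 6)).
rewrite /index_iota /= !big_cons big_nil addnE /= addr0 -!mulrDl !addrA.
congr (_ / 6).
by repeat congr (_ + _); congr (_ * f _); rewrite /L1 /L2 /L3 /L5; field.
Qed.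

(* Vertex [k] in the numbering from 1. *)
Local Notation vx k := (@Ordinal 11 k.-1 isT).

(** For odd p, U_{p,6} is i times a combination of the sines of l_1 t, l_3 t, l_5 t. The weights 2,
    -1, 2 complete the squares in C^2 / 6 to constants and its cross terms to cosines of (l_1 - l_3)
    t, (l_1 - l_5) t and (l_3 + l_5) t, which sum to C. Pairs are listed with p <= q, as
    [path11_sum] requires. *)
Definition path11_weights : seq (R * 'I_11 * 'I_11) :=
  [:: (-1, vx 1, vx 1); (1, vx 1, vx 11); (1, vx 2, vx 2); (-1, vx 2, vx 10);
      (-1, vx 3, vx 3); (1, vx 3, vx 9); (1, vx 4, vx 4); (-1, vx 4, vx 8);
      (-1, vx 5, vx 5); (1, vx 5, vx 7); (3 / 2, vx 6, vx 6);
      (2, vx 1, vx 6); (-1, vx 3, vx 6); (2, vx 5, vx 6)].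

Lemma path11_weighted_sum (t : R) :
  \sum_(w <- path11_weights) w.1.1 * path_prob w.1.2 w.2 t = 1 / 2.
Proof.
rewrite /path11_weights !big_cons big_nil /=.
rewrite /path_prob !path11_sum //= !cosN !sinN cos0 sin0.
have x2 : (Num.sqrt 2 : R) ^+ 2 - 2 = 0 by rewrite sqr_sqrtr// subrr.
have y2 : (Num.sqrt 3 : R) ^+ 2 - 3 = 0 by rewrite sqr_sqrtr// subrr.
set x := Num.sqrt 2; set y := Num.sqrt 3.
set a := x * (y + 1) / 2 * t; set b := x * (y - 1) / 2 * t.
(* This is l_1 = l_5 + l_3; only the angles of l_3 and l_5 remain for the odd eigenvalues. *)
have -> : a = b + x * t by rewrite /a /b; field.
have n5 := cos2Dsin2 b; have n3 := cos2Dsin2 (x * t).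
rewrite sinD cosD -/x -/y in x2 y2 *.
set c5 := cos b in n5 *; set s5 := sin b in n5 *.
set c3 := cos (x * t) in n3 *; set s3 := sin (x * t) in n3 *.
pose c1 := c5 * c3 - s5 * s3; pose s1 := s5 * c3 + c5 * s3.
(* What is left is a polynomial identity modulo x^2 = 2, y^2 = 3 and the two
   Pythagorean relations n_3 = n_5 = 1; [W] and the last factor are the cofactors of
   x^2 - 2 and y^2 - 3. *)
pose W := (2 * ((y - 1) / 4 * s1 - s3 / 2 + (y + 1) / 4 * s5) ^+ 2
  + 2 * ((y + 1) / 4 * s1 + s3 / 2 + (y - 1) / 4 * s5) ^+ 2
  - (s1 - s3 - s5) ^+ 2 / 4) / 9.
pose n_3 := c3 ^+ 2 + s3 ^+ 2; pose n_5 := c5 ^+ 2 + s5 ^+ 2.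
transitivity ((n_3 * n_5 + n_3 + n_5) / 6
  + (c3 * n_5 + c5 * n_3 + c1 - (c1 + c3 + c5)) / 3
  + (x ^+ 2 - 2) * W + (y ^+ 2 - 3) * ((s1 + s5) ^+ 2 / 18)).
  rewrite /n_3 /n_5 /W /c1 /s1; clearbody c3 s3 c5 s5; clear n3 n5 x2 y2.
  by field.
by rewrite x2 y2 /n_3 /n_5 n3 n5; field.
Qed.

(** * Integration of the combination *)

Lemma Rintegral_lincomb d (T : measurableType d) (mu : measure T R) (I : Type)
    (r : seq I) (w : I -> R) (F : I -> T -> R) :
  (forall i, mu.-integrable setT (EFin \o F i)) ->
  \int[mu]_t (\sum_(i <- r) w i * F i t) = \sum_(i <- r) w i * \int[mu]_t F i t.
Proof.
move=> iF.
have iwF i : mu.-integrable setT (EFin \o (fun t => w i * F i t)).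
  by have := integrableZl measurableT (w i) (iF i).
have isum s : mu.-integrable setT (EFin \o (fun t => \sum_(i <- s) w i * F i t)).
  rewrite (_ : EFin \o _ = fun t => \sum_(i <- s) (w i * F i t)%:E)%E; last first.
    by apply/funext => t /=; rewrite sumEFin.
  apply: integrable_sum => // i _; exact: (iwF i).
elim: r => [|i r IH].
  under eq_Rintegral do rewrite big_nil.
  by rewrite Rintegral_cst// mul0r big_nil.
under eq_Rintegral do rewrite big_cons.
by rewrite RintegralD // RintegralZl // big_cons IH.
Qed.

(** A continuous function bounded by twice the square of [B] is integrable for a finite measure. *)
Lemma path_prob_integrable (mu : probability (measurableTypeR R) R) n (p q : 'I_n) :
  mu.-integrable setT (EFin \o path_prob p q).
Proof.
have comp_scale (f : R -> R) (l : R) :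
    continuous f -> continuous (fun t : R => f (l * t)).
  by move=> cf t; apply: continuous_comp; [exact: mulrl_continuous | exact: cf].
pose B := \sum_(r < n) `|path_proj r p q| : R.
have bnd (f : R -> R) t : (forall x, `|f x| <= 1) ->
    `|(\sum_(r < n) path_proj r p q * f (path_eigval r * t)) ^+ 2| <= B ^+ 2.
  move=> f1; rewrite normrX lerXn2r ?nnegrE ?sumr_ge0 //.
  apply: (le_trans (ler_norm_sum _ _ _)); apply: ler_sum => r _.
  by rewrite normrM ler_piMr.
apply: measurable_bounded_integrable => //.
- exact: fin_num_fun_lty.
- apply: measurable_realfun.continuous_measurable_fun => t.
  have cvg2 (f : R -> R) : continuous f -> {for t, continuous (fun s : R =>
      (\sum_(r < n) path_proj r p q * f (path_eigval r * s)) ^+ 2)}.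
    move=> cf; have S : {for t, continuous (fun s : R =>
        \sum_(r < n) path_proj r p q * f (path_eigval r * s))}.
      apply: cvg_big => [|r _]; first exact: add_continuous.
      by apply: cvgMl_tmp; exact: comp_scale.
    exact: (cvgM S S).
  by apply: cvgD; apply: cvg2; [exact: continuous_cos | exact: continuous_sin].
exists (B ^+ 2 + B ^+ 2); split; first exact: num_real.
move=> M BM t _; apply: le_trans (ltW BM); apply: (le_trans (ler_normD _ _)).
by apply: lerD; apply: bnd => x; [exact: cos_max | exact: sin_max].
Qed.

End AverageMixing.

Theorem theorem2 (R : realType) (mu : probability (measurableTypeR R) R) :
  mxintegral mu (mixing_mx (adjacency_mx (@path_graph 11)))
    <> (11%:R : R[i])^-1 *: const_mx 1.
Proof.
move=> uniform.
have int_prob (p q : 'I_11) : \int[mu]_t path_prob p q t = 11^-1.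
  (* Real parts suffice, since the mixing matrix has real entries by [path_mixing]. *)
  have := congr1 (fun M : 'M[R[i]]_11 => complex.Re (M p q)) uniform.
  rewrite !mxE mulr1 -(rmorph_nat (real_complex R)) -fmorphV /= => <-.
  by apply: eq_Rintegral => t _; rewrite path_mixing.
have : 1 / 2 = \sum_(w <- path11_weights) w.1.1 * 11^-1 :> R.
  transitivity (\int[mu]_t (1 / 2 : R)).
    rewrite Rintegral_cst // -[LHS]mulr1; congr (_ * _).
    exact: (esym (congr1 fine (probability_setT mu))).
  transitivity (\int[mu]_t \sum_(w <- path11_weights) w.1.1 * path_prob w.1.2 w.2 t).
    by apply: eq_Rintegral => t _; rewrite path11_weighted_sum.
  rewrite (Rintegral_lincomb _ _ mu _ path11_weights (fun w => w.1.1)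
    (fun w => path_prob w.1.2 w.2)) => [|w]; last exact: path_prob_integrable.
  by apply: eq_bigr => w _; rewrite int_prob.
by rewrite !big_cons big_nil /=; lra.
Qed.
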